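(* For each $m$, $n$, $$\alpha_{mn} = \frac{\alpha_{1q}}{m + r\left(\frac{\alpha_{1q}}{\alpha_{1,q+1}} - 1\right)},$$ where $n = qm + r$, $q = \lfloor n/m \rfloor$. Here $\alpha_{mn}$ is the infimum of the precision of the approximate solution over all $m$-dimensional integer knapsack problems in $n$ variables (as defined in the context), and $\alpha_{1k}$ is the same quantity for one-dimensional knapsack problems ($m=1$) in $k$ variables.
   Context: $\mathbb{Z}_+$ and $\mathbb{R}_+$ denote the sets of all non-negative integers and non-negative real numbers respectively. For $A = (a_{ij}) \in \mathbb{R}_+^{m\times n}$ and $b = (b_i) \in \mathbb{R}_+^m$, put $L(A,b) = \{x \in \mathbb{Z}_+^n : Ax \le b\}$. For $c = (c_j)\in\mathbb{R}_+^n$, the integer $m$-dimensional knapsack problem is to maximize $cx = \sum_j c_j x_j$ subject to $x \in L(A,b)$. For $j = 1,\dots,n$ let $v^{(j)}$ be the point in $L(A,b)$ all of whose coordinates are $0$ except the $j$-th, which equals $v^{(j)}_j = \min_{i:\, a_{ij}>0} \lfloor b_i/a_{ij} \rfloor$. Let $V(A,b) = \{v^{(1)},\dots,v^{(n)}\}$. A point $v^{(j)}$ on which $\max_j cv^{(j)}$ is attained is called an approximate solution to the problem, and the precision of the approximate solution is $$\alpha(A,b,c) = \frac{\max_{x\in V(A,b)} cx}{\max_{x\in L(A,b)} cx}.$$ Define $$\alpha_{mn} = \inf\{\alpha(A,b,c) : A\in\mathbb{R}_+^{m\times n},\ b\in\mathbb{R}_+^m,\ c\in\mathbb{R}_+^n\}.$$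 It is known from earlier literature that for $m=1$, $\alpha_{1n} = \delta_n/\varepsilon_n$, where $\delta_1=\varepsilon_1=1$, $\delta_n = \delta_{n-1}(\delta_{n-1}+1)$, $\varepsilon_n = 1 + \varepsilon_{n-1}(\delta_{n-1}+1)$.
   Formalization: For n < m (q = 0) the formula uses α_{1,0}, which is undefined; there it is read as the limit as α_{1,0} tends to +∞ (giving 1/n). Also m, n ≥ 1, A has no zero column (else v^(j) is undefined), and instances with maximum 0 (precision 0/0) are excluded. *)

(* Defs.v *)
From mathcomp Require Import all_boot all_order all_algebra.
From mathcomp Require Import all_classical all_reals all_analysis.

Set Implicit Arguments.
Unset Strict Implicit.
Unset Printing Implicit Defensive.

Import Order.TTheory GRing.Theory Num.Theory.
Import numFieldNormedType.Exports.

Local Open Scope classical_set_scope.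
Local Open Scope ring_scope.

Section Knapsack.
Variables (R : realType) (m n : nat).
Implicit Types (A : 'M[R]_(m, n)) (b : 'cV[R]_m) (c : 'rV[R]_n).
Implicit Types (x : 'cV[nat]_n) (j : 'I_n).

Definition natcol x : 'cV[R]_n := map_mx (fun k : nat => k%:R) x.

Definition feasible A b : set 'cV[nat]_n :=
  [set x | forall i, (A *m natcol x) i 0 <= b i 0].

Definition objective c x : R := (c *m natcol x) 0 0.

(* For b, A >= 0 the quotients are nonnegative, so [Num.truncn] is the floor. *)
Definition ratios A b j : seq nat :=
  [seq Num.truncn (b i 0 / A i j) | i <- enum 'I_m & 0 < A i j].

(* The least element of [ratios A b j] when that list is nonempty. Since minn
   is idempotent, starting the fold at the head of the list is harmless. *)
Definition vheight A b j : nat :=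
  \big[minn/head 0%N (ratios A b j)]_(k <- ratios A b j) k.

Definition vpoint A b j : 'cV[nat]_n :=
  \col_k (if k == j then vheight A b j else 0%N).

Definition vpoints A b : set 'cV[nat]_n := range (vpoint A b).

Definition is_max (S : set R) (M : R) : Prop := S M /\ ubound S M.

(* A zero column of A would make the minimum defining v^(j) range over the empty
   set, so it is excluded; [feasible A b] is then finite and contains 0. *)
Definition admissible A b c : Prop :=
  [/\ forall i j, 0 <= A i j, forall i, 0 <= b i 0, forall j, 0 <= c 0 j
    & forall j, exists i, 0 < A i j].

(* When the optimum is 0 the quotient is 0/0; such instances have no precision. *)
Definition is_precision A b c (p : R) : Prop :=
  exists Mv Ml : R,
    [/\ is_max (objective c @` vpoints A b) Mv,
        is_max (objective c @` feasible A b) Ml,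
        0 < Ml & p = Mv / Ml].

End Knapsack.

(* For m, n > 0 this is the infimum of a nonempty set of positive reals; for
   m = 0 or n = 0 no instance has a precision and the value is meaningless. *)
Definition alpha (R : realType) (m n : nat) : R :=
  inf [set p | exists (A : 'M[R]_(m, n)) (b : 'cV[R]_m) (c : 'rV[R]_n),
                 admissible A b c /\ is_precision A b c p].

(* Main.v *)
Require Import Defs.
From mathcomp Require Import all_boot all_order all_algebra.
From mathcomp Require Import all_classical all_reals all_analysis.
From mathcomp Require Import ring lra.

Import Order.TTheory GRing.Theory Num.Theory.
Import numFieldNormedType.Exports.

Local Open Scope classical_set_scope.
Local Open Scope ring_scope.

(* Both sides are the reciprocal of  m beta_q + r / delta_q, where beta_k is the
   sum of the first k reciprocals of 1, 2, 6, 42, ... (beta_k = 1 / alpha_{1k}).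

   Upper bound on the optimum: assign each variable j to a row whose constraint
   determines v^(j). If row i receives k_i variables, its constraint gives
   sum x_j / (v_j + 1) < 1, while the objective is at most
   max_j c_j v_j * sum x_j / v_j. Replacing (x_j, v_j) by (1, floor (v_j / x_j))
   reduces to unit multiplicities, so that the sum of 1 / v_j has to be bounded
   by beta_k when sum 1 / (v_j + 1) < 1. By Curtiss' theorem on Egyptian
   fractions, proved as in Soundararajan's "Approximating 1 from below using n
   Egyptian fractions", the partial sums of 1 / (v_j + 1) are dominated by those
   of 1 / (delta_j + 1); since y / (1 - y) is increasing and convex, weak
   majorization transfers this to the sums of 1 / v_j. Concavity of k |-> beta_k
   then shows that equal splitting of the variables among the rows is extremal.

   Equality: m independent extremal one-row problems, at x = (1, ..., 1). *)

(** * The sequence [delta] and its reciprocal sums *)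

(* Indices are shifted: [delta i] is the paper's delta_{i+1}. *)
Fixpoint delta (i : nat) : nat :=
  if i is i'.+1 then (delta i' * (delta i').+1)%N else 1%N.

(* The paper's epsilon_k / delta_k, that is 1 / alpha_{1k}. *)
Definition beta (R : realType) (k : nat) : R := \sum_(i < k) (delta i)%:R^-1.

Lemma delta_gt0 i : (0 < delta i)%N.
Proof. by elim: i => //= i IH; rewrite muln_gt0 IH. Qed.

Lemma delta_le i j : (i <= j)%N -> (delta i <= delta j)%N.
Proof.
apply: (homo_leq (r := leq)) => //; first exact: leq_trans.
by move=> k /=; rewrite leq_pmulr.
Qed.

Lemma deltaS_lt i j : (i < j)%N -> ((delta i).+1 <= delta j)%N.
Proof. by move=> /delta_le; apply: leq_trans; rewrite leq_pmull ?delta_gt0. Qed.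

Lemma deltaR_gt0 (R : realType) i : 0 < (delta i)%:R :> R.
Proof. by rewrite ltr0n delta_gt0. Qed.

(** Telescoping: 1 / (d + 1) = 1 / d - 1 / (d (d + 1)). *)
Lemma sum_inv_deltaS (R : realType) k :
  \sum_(i < k) (delta i).+1%:R^-1 = 1 - (delta k)%:R^-1 :> R.
Proof.
elim: k => [|k IH]; first by rewrite big_ord0 invr1 subrr.
rewrite big_ord_recr /= IH natrM.
have := deltaR_gt0 R k; rewrite -natr1; set d := _%:R => d0.
by field; rewrite !gt_eqF //; lra.
Qed.

Lemma betaS (R : realType) k : beta R k.+1 = beta R k + (delta k)%:R^-1.
Proof. by rewrite /beta big_ord_recr. Qed.

Lemma beta_homo (R : realType) : {homo beta R : i j / (i <= j)%N >-> i <= j}.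
Proof.
apply: homo_leq => //; first exact: le_trans.
by move=> k; rewrite betaS lerDl invr_ge0 ler0n.
Qed.

(** Concavity: the increments 1 / [delta k] of [beta] are nonincreasing, so [beta] stays below its
    line of slope 1 / [delta q] through [q]. *)
Lemma beta_tangent (R : realType) k q :
  beta R k <= beta R q + (k%:R - q%:R) / (delta q)%:R.
Proof.
have step i j : (i <= j)%N -> (delta j)%:R^-1 <= (delta i)%:R^-1 :> R.
  by move=> ij; rewrite lef_pV2 ?posrE ?deltaR_gt0 // ler_nat delta_le.
have [kq|qk] := leqP k q.
- rewrite -(subnK kq); elim: (q - k)%N => [|d IH]; first by rewrite add0n subrr !mul0r addr0.
  rewrite addSn betaS; apply: (le_trans IH).
  have := step _ _ (leqnSn (d + k)); set x := (delta (d + k).+1)%:R^-1.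
  set y := (delta (d + k))%:R^-1; rewrite -[(d + k).+1%:R]natr1 natrD => xy.
  have d0 : 0 <= d%:R :> R by [].
  have : d%:R * x <= d%:R * y by rewrite ler_wpM2l.
  lra.
- rewrite -(subnK (ltnW qk)); elim: (k - q)%N => [|d IH]; first by rewrite add0n subrr !mul0r addr0.
  rewrite addSn betaS -natr1 natrD.
  have := step _ _ (leq_addl d q); move: IH; rewrite natrD; lra.
Qed.

(** * Egyptian fractions below 1 *)

Lemma sum_inv_prefix (R : realType) (v : nat -> nat) j k :
  (j <= k)%N ->
  \sum_(i < j) (v i).+1%:R^-1 <= \sum_(i < k) (v i).+1%:R^-1 :> R.
Proof.
move=> jk; rewrite -(subnK jk); elim: (k - j)%N => // d IH.
by rewrite addSn big_ord_recr /=; apply: (le_trans IH); rewrite lerDl invr_ge0.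
Qed.

(* The sum is a fraction with denominator the product. *)
Lemma sum_inv_gap (R : realType) (v : nat -> nat) k :
  \sum_(i < k) (v i).+1%:R^-1 < 1 :> R ->
  \sum_(i < k) (v i).+1%:R^-1 <= 1 - (\prod_(i < k) (v i).+1%:R)^-1 :> R.
Proof.
have P0 j : 0 < \prod_(i < j) (v i).+1%:R :> R by apply: prodr_gt0 => i _.
have [N EN] : exists N : nat,
    (\sum_(i < k) (v i).+1%:R^-1) * (\prod_(i < k) (v i).+1%:R) = N%:R :> R.
  elim: k => [|k [N IH]]; first by exists 0%N; rewrite !big_ord0 mul0r.
  exists (N * (v k).+1 + \prod_(i < k) (v i).+1)%N.
  rewrite !big_ord_recr /= natrD natrM natr_prod -IH mulrDl.
  by rewrite mulrA [X in _ + X]mulrC mulfK // pnatr_eq0.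
move: (P0 k); set S := \sum_(_ < _) _ in EN *.
rewrite -natr_prod in EN *; set P := (\prod_(_ < _) _)%N in EN *.
move=> p0 S1; have : (N < P)%N by rewrite -(ltr_nat R) -EN gtr_pMl.
rewrite -(ler_nat R) -natr1 -EN => NP.
by rewrite -(ler_pM2r p0) mulrBl mulVf ?gt_eqF // mul1r; lra.
Qed.

Lemma sum_inv_le (R : realType) (v : nat -> nat) k :
  {homo v : i j / (i <= j)%N} ->
  \sum_(i < k) (v i).+1%:R^-1 < 1 :> R ->
  \sum_(i < k) (v i).+1%:R^-1 <= \sum_(i < k) (delta i).+1%:R^-1 :> R.
Proof.
move=> vh S1.
pose S j : R := \sum_(i < j) (v i).+1%:R^-1.
pose T j : R := \sum_(i < j) (delta i).+1%:R^-1.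
(* The product of [(delta i).+1] over i < j is [delta j], so [D j] is the logarithm of the product
   of the [(v i).+1] divided by [delta j]. *)
pose D j : R := \sum_(i < j) ln ((v i).+1%:R / (delta i).+1%:R).
have S_lt1 j : (j <= k)%N -> S j < 1.
  by move=> jk; apply: le_lt_trans S1; exact: sum_inv_prefix.
have DE j : expR (D j) = (\prod_(i < j) (v i).+1%:R) / (delta j)%:R.
  elim: j => [|j IH]; first by rewrite /D !big_ord0 expR0 invr1 mulr1.
  rewrite /D big_ord_recr expRD -/(D j) IH lnK ?posrE ?divr_gt0 //=.
  by rewrite big_ord_recr /= natrM invfM; ring.
(* Where D j <= 0 the product of the v i + 1 is at most delta j and the gap bound
   suffices; elsewhere this is Abel summation of 1/d - 1/v >= ln (v / d) / v. *)
have main j : (j <= k)%N -> S j <= T j /\ D j / (v j).+1%:R <= T j - S j.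
  elim: j => [|j IH] jk; first by rewrite /S /T /D !big_ord0 mul0r subrr.
  have {IH} [ST DST] := IH (ltnW jk).
  have vlt : (v j.+1).+1%:R^-1 <= (v j).+1%:R^-1 :> R.
    by rewrite lef_pV2 ?posrE // ler_nat ltnS vh.
  have v0 : 0 < (v j.+1).+1%:R^-1 :> R by rewrite invr_gt0.
  have [D_le0|D_gt0] := leP (D j.+1) 0.
    have STj : S j.+1 <= T j.+1.
      rewrite /S /T sum_inv_deltaS; apply: le_trans (sum_inv_gap _ _ _ (S_lt1 _ jk)) _.
      rewrite lerD2l lerN2 lef_pV2 ?posrE ?deltaR_gt0 ?prodr_gt0 //.
      rewrite -[leRHS]mul1r -ler_pdivrMr ?deltaR_gt0 // -DE.
      by rewrite -expR0 ler_expR.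
    split=> //; apply: le_trans (_ : 0 <= _); last by rewrite subr_ge0.
    by rewrite mulr_le0_ge0 // ltW.
  suff H : D j.+1 / (v j.+1).+1%:R <= T j.+1 - S j.+1.
    by split=> //; rewrite -subr_ge0; apply: le_trans H; rewrite mulr_ge0 // ltW.
  have lnj : ln ((v j).+1%:R / (delta j).+1%:R) / (v j).+1%:R
             <= (delta j).+1%:R^-1 - (v j).+1%:R^-1 :> R.
    have H : ln ((v j).+1%:R / (delta j).+1%:R) <= (v j).+1%:R / (delta j).+1%:R - 1 :> R.
      rewrite -[X in ln X](subrK 1) [X in ln X]addrC le_ln1Dx //.
      by rewrite ltrBrDl subrr divr_gt0.
    rewrite -[leLHS]mulrC.
    apply: le_trans (ler_wpM2l _ H) _; first by rewrite invr_ge0.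
    by rewrite mulrBr mulr1 mulrA mulVf ?pnatr_eq0 // mul1r.
  have DS : D j.+1 = D j + ln ((v j).+1%:R / (delta j).+1%:R).
    by rewrite /D big_ord_recr.
  have SS : S j.+1 = S j + (v j).+1%:R^-1 by rewrite /S big_ord_recr.
  have TS : T j.+1 = T j + (delta j).+1%:R^-1 by rewrite /T big_ord_recr.
  (* As [D j.+1] is positive and [v] nondecreasing, the weight can be raised to that of index [j],
     where [DST] and [lnj] add up. *)
  apply: (le_trans (ler_wpM2l (ltW D_gt0) vlt)).
  rewrite DS mulrDl SS TS; apply: (le_trans (lerD DST lnj)).
  by rewrite addrACA -opprD.
exact: (main k (leqnn k)).1.
Qed.

(** * From 1 / (v + 1) to 1 / v, and multiplicities *)

Lemma sum_inv_pred_le (R : realType) (v : nat -> nat) k :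
  {homo v : i j / (i <= j)%N} -> (forall i, (0 < v i)%N) ->
  \sum_(i < k) (v i).+1%:R^-1 < 1 :> R ->
  \sum_(i < k) (v i)%:R^-1 <= beta R k.
Proof.
move=> vh v_gt0 S1.
(* Abel summation with decreasing weights w; [tangent] is the convexity of
   y / (1 - y) at y = 1 / (v + 1). *)
pose w i : R := ((v i).+1%:R / (v i)%:R) ^+ 2.
pose U j : R := \sum_(i < j) ((delta i).+1%:R^-1 - (v i).+1%:R^-1).
pose F j : R := \sum_(i < j) ((delta i)%:R^-1 - (v i)%:R^-1).
have U_ge0 j : (j <= k)%N -> 0 <= U j.
  move=> jk; rewrite /U sumrB subr_ge0; apply: sum_inv_le => //.
  by apply: le_lt_trans S1; exact: sum_inv_prefix.
have w_ge0 j : 0 <= w j by rewrite sqr_ge0.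
have w_step j : w j.+1 <= w j.
  have wE i : w i = (1 + (v i)%:R^-1) ^+ 2.
    by rewrite /w -natr1 mulrDl mul1r divff // pnatr_eq0 -lt0n.
  rewrite !wE ler_sqr ?nnegrE ?addr_ge0 ?invr_ge0 // lerD2l.
  by rewrite lef_pV2 ?posrE ?ltr0n // ler_nat vh.
have tangent j : w j * ((delta j).+1%:R^-1 - (v j).+1%:R^-1)
                 <= (delta j)%:R^-1 - (v j)%:R^-1.
  rewrite /w -!natr1; have := deltaR_gt0 R j; have := v_gt0 j.
  rewrite -(ltr0n R); move: (delta j)%:R (v j)%:R => d t t0 d0.
  rewrite -subr_ge0; set e := (X in 0 <= X).
  have -> : e = (d - t) ^+ 2 / (d * t ^+ 2 * (d + 1)).
    by rewrite /e; field; rewrite !gt_eqF //; lra.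
  by rewrite divr_ge0 ?sqr_ge0 // !mulr_ge0 ?sqr_ge0 //; lra.
have main j : (j <= k)%N -> w j * U j <= F j.
  elim: j => [|j IH] jk; first by rewrite /U /F !big_ord0 mulr0.
  apply: (le_trans (ler_wpM2r (U_ge0 _ jk) (w_step j))).
  rewrite /U /F !big_ord_recr /= mulrDr.
  exact: lerD (IH (ltnW jk)) (tangent j).
rewrite -subr_ge0 /beta -sumrB; apply: le_trans (main k (leqnn k)).
by rewrite mulr_ge0 // U_ge0.
Qed.

Lemma seq_sum_inv_le (R : realType) (s : seq nat) :
  all (leq 1) s -> \sum_(t <- s) t.+1%:R^-1 < 1 :> R ->
  \sum_(t <- s) t%:R^-1 <= beta R (size s).
Proof.
move=> s_gt0 S1.
have ps : perm_eq (sort leq s) s by rewrite perm_sort.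
rewrite -(perm_size ps); rewrite -!(perm_big _ ps) /= in S1 *.
have {ps} s_gt0 : all (leq 1) (sort leq s) by rewrite (perm_all _ ps).
move: (sort_sorted leq_total s) s_gt0 S1.
move: (sort leq s) => {}s s_sorted s_gt0 S1.
(* Defaulting to the last entry keeps [nth] nondecreasing beyond the end. *)
pose x0 := last 1%N s; pose v := nth x0 s.
have x0_gt0 : (0 < x0)%N.
  by rewrite /x0; case: s s_gt0 {S1 s_sorted x0 v} => // a s /allP; apply; exact: mem_last.
have v_gt0 i : (0 < v i)%N.
  have [si|si] := ltnP i (size s); last by rewrite /v nth_default.
  by apply: (allP s_gt0); exact: mem_nth.
have vh : {homo v : i j / (i <= j)%N}.
  move=> i j ij; have [js|sj] := ltnP j (size s).
    by apply: sorted_leq_nth; rewrite ?inE ?(leq_ltn_trans ij) //; exact: leq_trans.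
  rewrite [v j]nth_default //; have [si|si] := ltnP i (size s); last by rewrite /v nth_default.
  have s0 : (0 < size s)%N by apply: leq_ltn_trans si.
  rewrite /x0 (last_nth 1%N); have -> : nth 1%N (1%N :: s) (size s) = v (size s).-1.
    by rewrite -[X in nth _ _ X](prednK s0) /= (set_nth_default x0) // prednK.
  apply: sorted_leq_nth; rewrite ?inE ?prednK //; first exact: leq_trans.
  by rewrite -ltnS prednK.
have E (f : nat -> R) : \sum_(t <- s) f t = \sum_(i < size s) f (v i).
  by rewrite (big_nth x0) big_mkord.
rewrite E; apply: sum_inv_pred_le => //.
by rewrite -(E (fun t => t.+1%:R^-1)).
Qed.

(** For x > 0 put t = floor (v / x): then t x <= v < (t + 1) x gives x / v <= 1 / t and 1 / (t + 1)
    <= x / (v + 1). Terms with x = 0 are dropped, which is harmless as [beta] is monotone. *)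
Lemma mult_sum_inv_le (R : realType) (I : finType) (P : pred I) (x v : I -> nat) :
  (forall i, P i -> (x i <= v i)%N) ->
  \sum_(i | P i) (x i)%:R / (v i).+1%:R < 1 :> R ->
  \sum_(i | P i) (x i)%:R / (v i)%:R <= beta R #|P|.
Proof.
move=> xv S1.
pose s := [seq v i %/ x i | i <- enum I & P i && (0 < x i)]%N.
have sE (f : nat -> R) : \sum_(t <- s) f t = \sum_(i | P i && (0 < x i)%N) f (v i %/ x i)%N.
  by rewrite big_map big_filter big_enum_cond.
have t_gt0 i : P i -> (0 < x i)%N -> (0 < v i %/ x i)%N.
  by move=> Pi xi; rewrite divn_gt0 ?xv.
have s_gt0 : all (leq 1) s.
  apply/allP=> t /mapP[i]; rewrite mem_filter => /andP[/andP[Pi xi] _] ->; exact: t_gt0.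
apply: (@le_trans _ _ (beta R (size s))); last first.
  apply: beta_homo; rewrite size_map cardE.
  apply: uniq_leq_size => [|i]; first by rewrite filter_uniq // enum_uniq.
  by rewrite mem_filter mem_enum => /andP[/andP[]].
apply: le_trans (seq_sum_inv_le _ _ s_gt0 _).
  rewrite sE (bigID (fun i => 0 < x i)%N) /= [X in _ + X]big1 ?addr0; last first.
    by move=> i /andP[_]; rewrite lt0n negbK => /eqP->; rewrite mul0r.
  apply: ler_sum => i /andP[Pi xi]; rewrite ler_pdivrMr ?ltr0n ?(leq_trans xi (xv _ Pi)) //.
  rewrite mulrC ler_pdivlMr ?ltr0n ?t_gt0 // -natrM ler_nat mulnC.
  exact: leq_divM.
apply: le_lt_trans S1; rewrite sE [leRHS](bigID (fun i => 0 < x i)%N) /=.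
rewrite ler_wpDr ?sumr_ge0 //.
apply: ler_sum => i /andP[Pi xi]; rewrite ler_pdivlMr // mulrC ler_pdivrMr //.
rewrite -natrM ler_nat.
by rewrite mulnC ltn_ceil.
Qed.

(** * Heights and objective values *)

Lemma big_minn_mem (x0 : nat) (s : seq nat) :
  \big[minn/x0]_(k <- s) k \in x0 :: s.
Proof.
elim: s => [|a s IH]; first by rewrite big_nil mem_head.
rewrite big_cons /minn; case: ifP => _; first by rewrite !inE eqxx orbT.
by move: IH; rewrite !inE => /orP[->|->] //; rewrite !orbT.
Qed.

(** A positive entry makes [ratios] nonempty, so the default of the fold, its head, is one of its
    elements. *)
Lemma vheight_mem (R : realType) m n (A : 'M[R]_(m, n)) (b : 'cV[R]_m) j :
  (exists i, 0 < A i j) -> vheight A b j \in ratios A b j.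
Proof.
case=> i Aij; have := big_minn_mem (head 0%N (ratios A b j)) (ratios A b j).
rewrite -/(vheight A b j); have : Num.truncn (b i 0 / A i j) \in ratios A b j.
  by apply/mapP; exists i; rewrite // mem_filter Aij mem_enum.
by case: (ratios A b j) => //= a s _; rewrite !inE => /orP[/eqP->|//]; rewrite eqxx.
Qed.

Lemma vheightP (R : realType) m n (A : 'M[R]_(m, n)) (b : 'cV[R]_m) j :
  (exists i, 0 < A i j) ->
  exists2 i, 0 < A i j & vheight A b j = Num.truncn (b i 0 / A i j).
Proof.
move/(vheight_mem _ _ _ _ b)/mapP=> [i]; rewrite mem_filter => /andP[Aij _] ->.
by exists i.
Qed.

Lemma objectiveE (R : realType) n (c : 'rV[R]_n) (x : 'cV[nat]_n) :
  objective c x = \sum_j c 0 j * (x j 0)%:R.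
Proof. by rewrite /objective mxE; apply: eq_bigr => j _; rewrite mxE. Qed.

Lemma objective_vpoint (R : realType) m n (A : 'M[R]_(m, n)) (b : 'cV[R]_m)
    (c : 'rV[R]_n) j :
  objective c (vpoint A b j) = c 0 j * (vheight A b j)%:R.
Proof.
rewrite objectiveE (bigD1 j) //= mxE eqxx big1 ?addr0 // => k kj.
by rewrite mxE (negPf kj) mulr0.
Qed.

(** * Upper bound on the optimum *)

(* The reciprocal of alpha_{mn}; [beta_tangent] makes it the largest
   value of a sum of m terms beta k_i with k_1 + ... + k_m = n. *)
Definition gap (R : realType) (m n : nat) : R :=
  m%:R * beta R (n %/ m) + (n %% m)%:R / (delta (n %/ m))%:R.

(** All tangents are taken at the same [q]; their linear parts add up to n - #|I| q, the remainder
    of the division. *)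
Lemma sum_beta_le_gap (R : realType) (I : finType) (k : I -> nat) :
  \sum_i beta R (k i) <= gap R #|I| (\sum_i k i).
Proof.
set n := (\sum_i k i)%N; set q := (n %/ #|I|)%N.
apply: le_trans (ler_sum _ (fun i _ => beta_tangent R (k i) q)) _.
rewrite big_split /= -mulr_suml sumrB -natr_sum -/n !sumr_const.
rewrite -(mulr_natl (beta R q)) -(mulr_natl q%:R).
rewrite lerD2l ler_wpM2r ?invr_ge0 // -/q.
by rewrite {1}(divn_eq n #|I|) natrD natrM -/q [q%:R * _]mulrC addrAC subrr add0r.
Qed.

(** [M] is the best value on V(A,b) in the lower bound for [alpha], and 1 for the extremal
    instance. *)
Lemma objective_le_gap (R : realType) m n (A : 'M[R]_(m, n)) (b : 'cV[R]_m)
    (c : 'rV[R]_n) (M : R) (x : 'cV[nat]_n) :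
  admissible A b c -> 0 <= M ->
  (forall j, c 0 j * (vheight A b j)%:R <= M) ->
  feasible A b x -> objective c x <= M * gap R m n.
Proof.
move=> [A_ge0 b_ge0 c_ge0 A_col] M_ge0 cM xF.
have /fin_all_exists2[row A_row vE] := fun j => vheightP R m n A b j (A_col j).
pose v := vheight A b; pose y j := x j 0.
have rowE i : \sum_j A i j * (y j)%:R <= b i 0.
  apply: le_trans (xF i); rewrite mxE; apply: ler_sum => j _.
  by rewrite mxE.
have vlt j : b (row j) 0 < (v j).+1%:R * A (row j) j.
  by rewrite /v vE -ltr_pdivrMr // -truncn_le_nat.
have xv j : (y j <= v j)%N.
  rewrite /v vE truncn_ge_nat ?divr_ge0 // ler_pdivlMr // mulrC.
  apply: le_trans (rowE _); rewrite (bigD1 j) //= lerDl.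
  by apply: sumr_ge0 => k _; rewrite mulr_ge0.
(* Divide row [i] by [b i 0], using [vlt]. Strictness comes from one [j0] with [y j0] positive,
   which also forces [b i 0] to be positive; without such a [j0] the sum is 0. *)
have row_lt1 i : \sum_(j | row j == i) (y j)%:R / (v j).+1%:R < 1 :> R.
  have [/existsP[j0 /andP[/eqP rj0 xj0]]|] :=
      boolP [exists j, (row j == i) && (0 < y j)%N]; last first.
    rewrite negb_exists => /forallP no; rewrite big1 // => j ri.
    by have := no j; rewrite ri lt0n negbK => /eqP->; rewrite mul0r.
  have b_gt0 : 0 < b i 0.
    apply: lt_le_trans (rowE i); rewrite (bigD1 j0) //= ltr_pwDl //.
      by rewrite mulr_gt0 ?ltr0n // -rj0.
    by apply: sumr_ge0 => k _; rewrite mulr_ge0.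
  rewrite -(ltr_pM2r b_gt0) mul1r mulr_suml.
  apply: lt_le_trans (rowE i); rewrite [ltRHS](bigID (fun j => row j == i)) /=.
  apply: ltr_wpDr; first by apply: sumr_ge0 => k _; rewrite mulr_ge0.
  have le j : row j == i ->
      (y j)%:R / (v j).+1%:R * b i 0 <= A i j * (y j)%:R.
    move=> /eqP ri; rewrite [leRHS]mulrC -mulrA ler_wpM2l //.
    by rewrite mulrC ler_pdivrMr // mulrC -ri ltW.
  rewrite (bigD1 j0) ?rj0 //= [ltRHS](bigD1 j0) ?rj0 //=.
  apply: ltr_leD; last by apply: ler_sum => j /andP[/le].
  rewrite [ltRHS]mulrC -mulrA ltr_pM2l ?ltr0n //.
  by rewrite mulrC ltr_pdivrMr // mulrC -rj0.
rewrite objectiveE.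
apply: (@le_trans _ _ (\sum_j M * ((y j)%:R / (v j)%:R))).
  apply: ler_sum => j _; rewrite -/(y j); have [->|x_gt0] := posnP (y j).
    by rewrite mul0r !mulr0.
  have v_gt0 : 0 < (v j)%:R :> R by rewrite ltr0n (leq_trans x_gt0).
  rewrite mulrCA [leLHS]mulrC ler_wpM2l //.
  by rewrite ler_pdivlMr.
rewrite -mulr_sumr ler_wpM2l // (partition_big row xpredT) //=.
apply: (@le_trans _ _ (\sum_i beta R #|[pred j | row j == i]|)).
  by apply: ler_sum => i _; apply: mult_sum_inv_le.
apply: le_trans (sum_beta_le_gap _ _ _) _; rewrite card_ord.
suff -> : (\sum_i #|[pred j | row j == i]|)%N = n by [].
rewrite -[RHS]card_ord -sum1_card (partition_big row xpredT) //=.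
by apply: eq_bigr => i _; rewrite sum1_card.
Qed.

(** * The extremal instance *)

(* Variable j is the (j %/ m)-th variable of row j %% m. *)
Definition tight_A (R : realType) (m n : nat) : 'M[R]_(m, n) :=
  \matrix_(i, j) (if (j %% m == i)%N then (delta (j %/ m)).+1%:R^-1 else 0).

(** By [sum_inv_deltaS], the sum of 1 / (delta l + 1) over l <= n %/ m: room for one variable more
    than the quotient in each row. *)
Definition tight_b (R : realType) (m n : nat) : 'cV[R]_m :=
  \col_i (1 - (delta (n %/ m).+1)%:R^-1).

(** Normalized so that every [vpoint] has objective value 1. *)
Definition tight_c (R : realType) (m n : nat) : 'rV[R]_n :=
  \row_j (delta (j %/ m))%:R^-1.

Lemma tight_admissible (R : realType) (m n : nat) :
  (0 < m)%N -> admissible (tight_A R m n) (tight_b R m n) (tight_c R m n).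
Proof.
move=> m_gt0; split=> [i j|i|j|j]; rewrite ?mxE ?invr_ge0 //.
- by case: ifP.
- by rewrite subr_ge0 invf_le1 ?deltaR_gt0 // ler1n delta_gt0.
- exists (Ordinal (ltn_pmod j m_gt0)).
  by rewrite mxE /= eqxx invr_gt0.
Qed.

(** With d = [delta (j %/ m)] and e = [delta (n %/ m).+1], the ratio (d + 1)(1 - 1 / e) lies in [d,
    d + 1) because d + 1 <= e. *)
Lemma tight_vheight (R : realType) (m n : nat) (j : 'I_n) :
  (0 < m)%N -> vheight (tight_A R m n) (tight_b R m n) j = delta (j %/ m).
Proof.
move=> m_gt0; have [_ _ _ col] := tight_admissible R m n m_gt0.
have [i Aij ->] := vheightP _ _ _ _ (tight_b R m n) j (col j).
move: Aij; rewrite !mxE; case: ifP => [_ _|]; last by rewrite ltxx.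
have lq : (j %/ m < (n %/ m).+1)%N by rewrite ltnS leq_div2r // ltnW.
have dl := deltaS_lt _ _ lq.
have d_gt0 : 0 < (delta (n %/ m).+1)%:R :> R by rewrite deltaR_gt0.
apply: truncn_def; rewrite invrK mulrBl mul1r; apply/andP; split.
  rewrite -[X in X - _]natr1 -addrA lerDl subr_ge0 mulrC ler_pdivrMr //.
  by rewrite mul1r ler_nat.
by rewrite gtrBl mulr_gt0 ?invr_gt0.
Qed.

Lemma sum_divn (R : realType) (f : nat -> R) m q r :
  (r < m)%N ->
  \sum_(j < q * m + r) f (j %/ m)%N = m%:R * (\sum_(l < q) f l) + r%:R * f q.
Proof.
move=> rm; have m_gt0 : (0 < m)%N by apply: leq_ltn_trans rm.
have block k t : (t <= m)%N ->
    \sum_(k * m <= j < k * m + t) f (j %/ m)%N = t%:R * f k.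
  move=> tm; rewrite -[X in \sum_(X <= _ < _) _]add0n [(k * m + t)%N]addnC big_addn addnK big_mkord.
  rewrite (eq_bigr (fun=> f k)) => [|i _].
    by rewrite sumr_const card_ord mulr_natl.
  by rewrite addnC divnMDl // divn_small ?addn0 // (leq_trans (ltn_ord i)).
rewrite -(big_mkord xpredT (fun j => f (j %/ m)%N)).
rewrite (big_cat_nat (n := (q * m)%N)) ?leq_addr //= block ?(ltnW rm) //; congr (_ + _).
elim: q => [|q IH]; first by rewrite mul0n big_geq // big_ord0 mulr0.
rewrite mulSn addnC (big_cat_nat (n := (q * m)%N)) ?leq_addr //= IH block //.
by rewrite big_ord_recr /= mulrDr.
Qed.

Lemma tight_feasible (R : realType) (m n : nat) :
  (0 < m)%N -> feasible (tight_A R m n) (tight_b R m n) (const_mx 1%N).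
Proof.
move=> m_gt0 i; rewrite !mxE -sum_inv_deltaS.
rewrite (eq_bigr (fun j : 'I_n => if (j %% m == i)%N then (delta (j %/ m)).+1%:R^-1 else 0));
  last by move=> j _; rewrite !mxE mulr1.
set f := fun j : nat => if (j %% m == i)%N then (delta (j %/ m)).+1%:R^-1 else 0 : R.
have f_ge0 j : 0 <= f j by rewrite /f; case: ifP.
have le_n : (n <= (n %/ m).+1 * m)%N by rewrite ltnW // ltn_ceil.
(* Complete the last block of [m] indices; each block then contains exactly one variable of row
   [i]. *)
apply: (@le_trans _ _ (\sum_(0 <= j < (n %/ m).+1 * m) f j)).
  rewrite -(big_mkord xpredT f) [leRHS](big_cat_nat (n := n)) //= lerDl.
  by apply: sumr_ge0.
elim: (n %/ m).+1 => [|q IH]; first by rewrite mul0n big_geq // big_ord0.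
rewrite mulSn addnC (big_cat_nat (n := (q * m)%N)) ?leq_addr //= big_ord_recr /=.
apply: lerD => //; rewrite -[X in \sum_(X <= _ < _) _]add0n [(q * m + m)%N]addnC big_addn addnK big_mkord.
rewrite (bigD1 i) //= big1 ?addr0 => [|k ki].
  by rewrite /f addnC modnMDl divnMDl // modn_small // divn_small // eqxx addn0.
rewrite /f addnC modnMDl modn_small //; case: eqP => // E.
by case/eqP: ki; exact: val_inj.
Qed.

Lemma tight_objective (R : realType) (m n : nat) :
  (0 < m)%N -> objective (tight_c R m n) (const_mx 1%N) = gap R m n.
Proof.
move=> m_gt0; rewrite objectiveE.
rewrite (eq_bigr (fun j : 'I_n => (delta (j %/ m))%:R^-1)) => [|j _]; last first.
  by rewrite !mxE mulr1.
rewrite -(big_mkord xpredT (fun j => (delta (j %/ m))%:R^-1 : R)) {1}(divn_eq n m).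
by rewrite big_mkord (sum_divn _ (fun l => (delta l)%:R^-1 : R)) // ltn_pmod.
Qed.

(** * The value of [alpha] *)

Lemma gap_gt0 (R : realType) m n : (0 < m)%N -> (0 < n)%N -> 0 < gap R m n.
Proof.
move=> m_gt0 n_gt0; rewrite /gap /beta.
case: (posnP (n %/ m)) => [q0|q_gt0].
  rewrite q0 big_ord0 mulr0 add0r invr1 mulr1 ltr0n.
  by move: n_gt0; rewrite {1}(divn_eq n m) q0.
rewrite ltr_pwDl ?divr_ge0 // mulr_gt0 ?ltr0n //.
rewrite -(prednK q_gt0) big_ord_recl ltr_pwDl ?invr_gt0 //=.
by apply: sumr_ge0.
Qed.

Lemma alphaE (R : realType) m n :
  (0 < m)%N -> (0 < n)%N -> alpha R m n = (gap R m n)^-1.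
Proof.
move=> m_gt0 n_gt0; rewrite /alpha; set E := (X in inf X).
have g_gt0 := gap_gt0 R m n m_gt0 n_gt0.
have lbE : lbound E (gap R m n)^-1.
  move=> p [A [b [c [adm [Mv [Ml [[_ ubv] [[x xF <-] _] Ml_gt0 ->]]]]]]].
  have [A_ge0 b_ge0 c_ge0 A_col] := adm.
  have cM j : c 0 j * (vheight A b j)%:R <= Mv.
    by rewrite -objective_vpoint; apply: ubv; exists (vpoint A b j) => //; exists j.
  have Mv_ge0 : 0 <= Mv by apply: le_trans (cM (Ordinal n_gt0)); rewrite mulr_ge0.
  rewrite ler_pdivlMr // mulrC ler_pdivrMr //.
  exact: objective_le_gap adm Mv_ge0 cM xF.
have E_gap : E (gap R m n)^-1.
  exists (tight_A R m n), (tight_b R m n), (tight_c R m n).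
  have adm := tight_admissible R m n m_gt0; split=> //.
  have c1 j : tight_c R m n 0 j * (vheight (tight_A R m n) (tight_b R m n) j)%:R = 1.
    by rewrite tight_vheight // mxE mulVf // gt_eqF // deltaR_gt0.
  exists 1, (gap R m n); split=> //; last by rewrite div1r.
  - split=> [|_ [_ [j _ <-] <-]]; last by rewrite objective_vpoint c1.
    exists (vpoint (tight_A R m n) (tight_b R m n) (Ordinal n_gt0)).
      by exists (Ordinal n_gt0).
    by rewrite objective_vpoint c1.
  - split=> [|_ [x xF <-]].
      exists (const_mx 1%N); [exact: tight_feasible | exact: tight_objective].
    rewrite -[leRHS]mul1r; apply: objective_le_gap adm _ _ xF => // j.
    by rewrite c1.
apply/eqP; rewrite eq_le; apply/andP; split.
  by apply: ge_inf => //; exists (gap R m n)^-1.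
by apply: lb_le_inf => //; exists (gap R m n)^-1.
Qed.

Lemma alpha1E (R : realType) k : (0 < k)%N -> alpha R 1 k = (beta R k)^-1.
Proof.
by move=> k_gt0; rewrite alphaE // /gap divn1 modn1 mul1r mul0r addr0.
Qed.

Theorem theorem1 (R : realType) (m n q r : nat)
    (m_gt0 : (0 < m)%N) (n_gt0 : (0 < n)%N)
    (q_def : q = (n %/ m)%N) (r_def : n = (q * m + r)%N) :
  ((0 < q)%N ->
     alpha R m n =
       alpha R 1 q / (m%:R + r%:R * (alpha R 1 q / alpha R 1 q.+1 - 1)))
  /\
  (* q = 0: alpha_{1,0}, an infimum over the empty set, is read as +oo, and the
     same right-hand side is taken in the limit a --> +oo of that value *)
  (q = 0%N ->
     a / (m%:R + r%:R * (a / alpha R 1 q.+1 - 1)) @[a --> +oo]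
       --> alpha R m n).
Proof.
have r_mod : (n %% m)%N = r.
  by apply: (@addnI (q * m)%N); rewrite -r_def q_def -divn_eq.
have aE : alpha R m n = (m%:R * beta R q + r%:R / (delta q)%:R)^-1.
  by rewrite alphaE // /gap r_mod -q_def.
split=> [q_gt0|q0].
  (* By [betaS], alpha_{1q} / alpha_{1,q+1} - 1 = 1 / (beta_q delta_q). *)
  rewrite aE !alpha1E // invrK betaS.
  have B_gt0 : 0 < beta R q.
    by have := gap_gt0 R 1 q isT q_gt0; rewrite /gap divn1 modn1 mul1r mul0r addr0.
  have W_gt0 : 0 < m%:R * beta R q + r%:R / (delta q)%:R.
    by rewrite ltr_pwDl ?divr_ge0 // mulr_gt0 // ltr0n.
  rewrite -invfM; congr _^-1; have := deltaR_gt0 R q.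
  by move=> d_gt0; field; rewrite !gt_eqF.
have rn : r = n by rewrite r_def q0.
have beta1 : beta R 1 = 1 by rewrite /beta big_ord1 invr1.
rewrite aE q0 /beta big_ord0 mulr0 add0r invr1 mulr1.
rewrite rn alpha1E // beta1 invr1.
have inv_cvg0 : (a^-1 : R) @[a --> +oo] --> (0 : R).
  by apply/(gtr0_cvgV0 (f := id)) => //; exact: nbhs_pinfty_gt.
(* This is a / (m + n (a - 1)) with numerator and denominator divided by [a]. *)
have lim_r : (((m%:R - n%:R) * a^-1 + n%:R)^-1 : R) @[a --> +oo] --> (n%:R^-1 : R).
  apply: cvgV; first by rewrite pnatr_eq0 -lt0n.
  rewrite -[X in _ --> X]add0r -[X in _ --> X + _](mulr0 (m%:R - n%:R : R)).
  by apply: cvgD; [apply: cvgM => //; exact: cvg_cst | exact: cvg_cst].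
apply: cvg_trans lim_r; apply: near_eq_cvg; near=> a.
have a_gt0 : 0 < a by near: a; exact: nbhs_pinfty_gt.
have -> : (m%:R - n%:R) * a^-1 + n%:R = (m%:R + n%:R * (a / 1 - 1)) / a.
  by field; rewrite gt_eqF.
by rewrite invf_div.
Unshelve. all: by end_near.
Qed.
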